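(* $$\mathcal{P}(\overline{\Omega})\cap\big(\mathbb{R}\times\{0,1\}^d\big)=\mathcal{P}(\widehat{\Omega})\cap\big(\mathbb{R}\times\{0,1\}^d\big).$$ Thus, for any $\mathbf{x}\in\mathcal{X}\cap\{0,1\}^d$, $$g_s\big(\boldsymbol{\lambda}(\mathbf{V}\,\mathrm{Diag}(\mathbf{x})\,\mathbf{V}^\top)\big)=f_s\big(\boldsymbol{\lambda}(\mathbf{V}\,\mathrm{Diag}(\mathbf{x})\,\mathbf{V}^\top)\big).$$
   Context: $\mathbb{S}^d_+$ is the cone of real symmetric positive semidefinite $d\times d$ matrices; $\boldsymbol{\lambda}(\mathbf{X})$ is the vector of eigenvalues in nonincreasing order. $\varphi:\mathbb{R}_{++}\to\mathbb{R}$ is closed, convex, nonincreasing, extended by $+\infty$ outside $\mathbb{R}_{++}$ (closed: the extension is lower semicontinuous). $1\le s\le d$ is an integer, $f_s(\boldsymbol{\xi})=\sum_{i=1}^s\varphi(\xi_i)$. $\mathbf{V}\in\mathbb{R}^{d\times d}$, $\mathbf{C}=\mathbf{V}^\top\mathbf{V}$ with $s\le\operatorname{rank}(\mathbf{C})$, and $\mathcal{X}=\{\mathbf{x}\in[0,1]^d:\mathbf{1}^\top\mathbf{x}=s,\ \mathbf{A}\mathbf{x}\le\mathbf{b}\}$ for given $\mathbf{A},\mathbf{b}$. $\mathbb{K}_{o,d}=\{\mathbf{x}\in\mathbb{R}^d: x_1\ge\dots\ge x_d\}$. $\mathbf{u}\succcurlyeq_m\mathbf{w}$ (majorization) means $\sum_i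 u_i=\sum_i w_i$ and for each $j\le d-1$ the sum of the $j$ largest entries of $\mathbf{u}$ is at least that of $\mathbf{w}$. $$g_s(\boldsymbol{\lambda})=\min_{\boldsymbol{\xi}\in\mathbb{R}^d_+}\{f_s(\boldsymbol{\xi}):\ \boldsymbol{\xi}\succcurlyeq_m\boldsymbol{\lambda},\ \boldsymbol{\xi}\in\mathbb{K}_{o,d}\},$$ $$\overline{\Omega}=\{(\boldsymbol{\xi},\mathbf{X})\in\mathbb{R}^d_+\times\mathbb{S}^d_+:\ \boldsymbol{\xi}=\boldsymbol{\lambda}(\mathbf{X}),\ \boldsymbol{\xi}\in\mathbb{K}_{o,d}\},\qquad \widehat{\Omega}=\{(\boldsymbol{\xi},\mathbf{X})\in\mathbb{R}^d_+\times\mathbb{S}^d_+:\ \boldsymbol{\xi}\succcurlyeq_m\boldsymbol{\lambda}(\mathbf{X}),\ \boldsymbol{\xi}\in\mathbb{K}_{o,d}\},$$ and for $\Omega\subseteq\mathbb{R}^d\times\mathbb{S}^d$, $$\mathcal{P}(\Omega)=\{(t,\mathbf{x})\in\mathbb{R}\times\mathcal{X}:\ \exists\boldsymbol{\xi}\in\mathbb{R}^d_+\text{ s.t. }t\ge f_s(\boldsymbol{\xi}),\ (\boldsymbol{\xi},\mathbf{V}\mathrm{Diag}(\mathbf{x})\mathbf{V}^\top)\in\Omega\}.$$ *)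

(* Defs.v *)
From HB Require Import structures.
From mathcomp Require Import all_boot all_order all_algebra.
From mathcomp Require Import all_classical all_reals all_analysis complex.

Set Implicit Arguments.
Unset Strict Implicit.
Unset Printing Implicit Defensive.

Import Order.TTheory GRing.Theory Num.Theory.
Import numFieldNormedType.Exports.

Local Open Scope classical_set_scope.
Local Open Scope ring_scope.

Section Defs.
Context {R : realType} {d : nat}.
Implicit Types (u w x xi l : 'cV[R]_d) (X V : 'M[R]_d) (phi : R -> R).

Definition nonneg_vec u := forall i, 0 <= u i 0.

Definition psdmx X := X^T = X /\ forall v : 'cV[R]_d, 0 <= (v^T *m X *m v) 0 0.

(* The cone K_{o,d}. *)
Definition ordered_vec u := forall i j : 'I_d, (i <= j)%N -> u j 0 <= u i 0.

Definition is_eigvals X l :=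
  ordered_vec l /\ char_poly X = \prod_i ('X - (l i 0)%:P).

(* Eigenvalues with multiplicity, in nonincreasing order.  For symmetric X the
   vector exists and is unique (eigvalsP, is_eigvals_uniq); the default 0 is for
   matrices whose spectrum is not real. *)
Definition eigvals X : 'cV[R]_d := xget 0 [set l | is_eigvals X l].

Definition sum_largest (j : nat) u : R :=
  \sum_(v <- take j (sort >=%R [seq u i 0 | i : 'I_d])) v.

Definition majorizes u w :=
  \sum_i u i 0 = \sum_i w i 0 /\
  forall j, (j < d)%N -> sum_largest j w <= sum_largest j u.

(* The extension by +oo of the restriction of phi to the positive reals: the
   values of phi on nonpositive reals are never used. *)
Definition ext_phi phi (t : R) : \bar R := if 0 < t then (phi t)%:E else +oo%E.

Definition f_s phi (s : nat) xi : \bar R :=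
  (\sum_(i < d | (i < s)%N) ext_phi phi (xi i 0%R))%E.

(* The minimum, as an infimum in the extended reals: it is attained whenever
   the feasible set, which is compact, is nonempty and the extension of phi is
   lower semicontinuous. *)
Definition g_s phi (s : nat) l : \bar R :=
  ereal_inf [set f_s phi s xi | xi in
    [set xi | [/\ nonneg_vec xi, majorizes xi l & ordered_vec xi]]].

Definition Omega_bar : set ('cV[R]_d * 'M[R]_d) :=
  [set p | [/\ nonneg_vec p.1, psdmx p.2, p.1 = eigvals p.2 & ordered_vec p.1]].

Definition Omega_hat : set ('cV[R]_d * 'M[R]_d) :=
  [set p | [/\ nonneg_vec p.1, psdmx p.2, majorizes p.1 (eigvals p.2)
             & ordered_vec p.1]].

Definition VDiagVT V x : 'M[R]_d := V *m diag_mx x^T *m V^T.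

Definition feasible (m : nat) (A : 'M[R]_(m, d)) (b : 'cV[R]_m) (s : nat) :
    set 'cV[R]_d :=
  [set x : 'cV[R]_d | [/\ forall i, 0 <= x i 0 <= 1,
               \sum_i x i 0 = s%:R
             & forall k, (A *m x) k 0 <= b k 0]].

Definition binary_vec : set 'cV[R]_d :=
  [set x : 'cV[R]_d | forall i, x i 0 = 0 \/ x i 0 = 1].

Definition proj_set phi (s : nat) V (calX : set 'cV[R]_d)
    (Omega : set ('cV[R]_d * 'M[R]_d)) : set (R * 'cV[R]_d) :=
  [set p | calX p.2 /\
    exists xi, [/\ nonneg_vec xi, (f_s phi s xi <= p.1%:E)%E
                 & Omega (xi, VDiagVT V p.2)]].

End Defs.

Lemma is_eigvals_uniq (R : realType) d (X : 'M[R]_d) l1 l2 :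
  is_eigvals X l1 -> is_eigvals X l2 -> l1 = l2.
Proof.
have so (l : 'cV[R]_d) : ordered_vec l -> sorted >=%R [seq l i 0 | i : 'I_d].
  move=> ol; rewrite sorted_map; have : sorted (relpre val leq) (enum 'I_d).
    by rewrite -sorted_map val_enum_ord iota_sorted.
  by apply: sub_sorted => i j /= ij; exact: ol.
move=> [h1 e1] [h2 e2]; have : perm_eq [seq l1 i 0 | i : 'I_d] [seq l2 i 0 | i : 'I_d].
  by apply: prod_XsubC_eq; rewrite !big_image/= -e1 -e2.
move=> /(sorted_eq ge_trans ge_anti (so _ h1) (so _ h2)) /eq_in_map h.
by apply/colP => i; apply: h; rewrite mem_enum.
Qed.

Lemma eigvalsP (R : realType) d (X : 'M[R]_d) :
  X^T = X -> is_eigvals X (eigvals X).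
Proof.
move=> sX; suff [l lP] : exists l, is_eigvals X l.
  by apply: (@xgetPex _ 0 [set l | is_eigvals X l]); exists l.
pose C := (complex R : numClosedFieldType).
pose f : {rmorphism R -> C} := real_complex R.
pose XC := map_mx f X.
have XCh : XC \is hermitianmx _ false (@Num.conj C).
  rewrite is_hermitianmxE expr0 scale1r; apply/eqP/matrixP => i j.
  rewrite !mxE -[in LHS]sX mxE; apply/esym/CrealP.
  by rewrite complex_real /= eqxx.
have /orthomx_spectralP XE := hermitian_normalmx XCh.
have := hermitian_spectral_diag_real XCh.
set D := spectral_diag XC; set P := spectralmx XC => Dreal.
pose r : seq R := sort >=%R [seq complex.Re (D 0 i) | i : 'I_d].
have sr : size r = d by rewrite size_sort size_image card_ord.
exists (\col_i r`_i); split.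
  move=> i j ij; rewrite !mxE.
  by apply: (sorted_leq_nth ge_trans ge_refl 0 (sort_sorted ge_total _)) => //;
    rewrite inE sr ltn_ord.
apply: (map_poly_inj f); rewrite map_char_poly -/XC.
have Pu : P \in unitmx by exact: spectral_unit.
have -> : char_poly XC = char_poly (diag_mx D).
  rewrite /char_poly /char_poly_mx.
  have PE : map_mx polyC P *m ('X%:M - map_mx polyC XC) =
            ('X%:M - map_mx polyC (diag_mx D)) *m map_mx polyC P.
    rewrite mulmxBr mulmxBl -!map_mxM scalar_mxC; congr (_ - map_mx _ _).
    by rewrite [in LHS]XE !mulmxA mulmxV// mul1mx.
  have := congr1 determinant PE; rewrite !det_mulmx mulrC => /mulIf; apply.
  by rewrite det_map_mx polyC_eq0 -unitfE -unitmxE.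
rewrite char_poly_trig; last by apply: diag_mx_is_trig.
rewrite rmorph_prod.
transitivity (\prod_(v <- r) ('X - (f v)%:P)).
  rewrite (perm_big _ (permEl (perm_sort _ _))) big_image/=.
  apply: eq_bigr => i _; rewrite mxE eqxx mulr1n; congr ('X - _%:P).
  have /mxOverP/(_ 0 i) := Dreal.
  by case: (D 0 i) => a b; rewrite complex_real => /eqP ->.
rewrite (big_nth 0) sr big_mkord; apply: eq_bigr => i _.
by rewrite rmorphB/= map_polyX map_polyC/= mxE.
Qed.

(* Main.v *)
Require Import Defs.
From HB Require Import structures.
From mathcomp Require Import all_boot all_order all_algebra.
From mathcomp Require Import all_classical all_reals all_analysis ring lra.

Set Implicit Arguments.
Unset Strict Implicit.
Unset Printing Implicit Defensive.

Import Order.TTheory GRing.Theory Num.Theory.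
Import numFieldNormedType.Exports.

Local Open Scope classical_set_scope.
Local Open Scope ring_scope.

(** A binary point [x] of the feasible set has exactly [s] ones, so that the
    matrix [X = V Diag(x) V^T] has rank at most [s]. It is positive semidefinite;
    its ordered eigenvalue vector [l] is therefore nonnegative and vanishes
    beyond the first [s] coordinates ([is_eigvals_rank]).

    Let [xi] be nonnegative, nonincreasing, and majorize [l]. The sum of its
    first [s] entries is at least the total of [l], which is the total of [xi];
    hence [xi] also carries all its mass on the first [s] coordinates, and these
    coordinates of [xi] majorize those of [l] ([majorizes_prefix_eq]). If one of
    them is zero, [f_s] is infinite at [xi]. Otherwise the first [s] entries of
    [l] are positive too, and Karamata's inequality for the convex function
    [phi] gives [f_s l <= f_s xi] ([karamata], [f_s_majorizes]).

    So [l], which majorizes itself, minimizes [f_s] among these [xi], and this is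
    the second claim. For the first, a witness [xi] for the relaxed set may be
    replaced by [l], which is a witness for the original set and has no larger
    value; the other inclusion is the reflexivity of majorization. *)

(** * Convexity and Karamata's inequality *)

(** Convexity at [x] written as a convex combination of [a] and [b], with the
    denominator [b - a] cleared: the comparison of the slopes of two adjacent
    chords is linear in this form. *)
Lemma convex_three_points (R : realType) (phi : R -> R) (a x b : R) :
  convex_function (`]0, +oo[%classic : set R) phi ->
  0 < a -> a < x -> x < b ->
  (b - a) * phi x <= (b - x) * phi a + (x - a) * phi b.
Proof.
move=> phi_convex a0 ax xb.
have ab0 : 0 < b - a by rewrite subr_gt0 (lt_trans ax).
have abN : b - a != 0 by rewrite gt_eqF.
have t0 : 0 <= (b - x) / (b - a) by rewrite divr_ge0 ?subr_ge0 ?ltW ?(lt_trans ax).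
have t1 : (b - x) / (b - a) <= 1 by rewrite ler_pdivrMr// mul1r lerD2l lerN2 ltW.
have pos y : 0 < y -> y \in (`]0, +oo[%classic : set R).
  by move=> y0; rewrite inE/= in_itv/= y0.
set t := (b - x) / (b - a).
have xE : t * a + (1 - t) * b = x by rewrite /t; field.
have : phi (t * a + (1 - t) * b) <= t * phi a + (1 - t) * phi b.
  have b0 := lt_trans a0 (lt_trans ax xb).
  by have := phi_convex (Itv01 t0 t1) a b (pos _ a0) (pos _ b0); rewrite !convRE.
rewrite xE -(ler_pM2l ab0) => /le_trans; apply.
by rewrite le_eqVlt; apply/orP; left; apply/eqP; rewrite /t; field.
Qed.

(** At [x] the supremum of the slopes of the chords ending at [x] from the left
    works: it is finite because every such slope is at most the slope of any
    chord starting at [x], and this same bound gives the inequality to the right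
    of [x]. The slopes are chosen by one function [c] so that equal points
    receive equal slopes, as the monotonicity in [karamata] requires. *)
Lemma convex_subgradient (R : realType) (phi : R -> R) :
  convex_function (`]0, +oo[%classic : set R) phi ->
  exists c : R -> R, forall x y, 0 < x -> 0 < y ->
    phi x + c x * (y - x) <= phi y.
Proof.
move=> phi_convex.
pose slopes x := [set (phi x - phi a) / (x - a) | a in [set a | 0 < a < x]].
have slopes_le x b : 0 < x -> x < b ->
    ubound (slopes x) ((phi b - phi x) / (b - x)).
  move=> x0 xb _ [a /= /andP[a0 ax] <-].
  have := convex_three_points phi_convex a0 ax xb.
  have xa0 : 0 < x - a by rewrite subr_gt0.
  have bx0 : 0 < b - x by rewrite subr_gt0.
  by rewrite ler_pdivrMr// mulrAC ler_pdivlMr//; nra.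
exists (fun x => sup (slopes x)) => x y x0 y0.
have [yx|xy|->] := ltgtP y x; last by rewrite subrr mulr0 addr0.
- have : (phi x - phi y) / (x - y) <= sup (slopes x).
    apply: ub_le_sup; last by exists y => //=; rewrite y0 yx.
    by exists ((phi (x + 1) - phi x) / (x + 1 - x)); apply: slopes_le => //; lra.
  by rewrite ler_pdivrMr ?subr_gt0//; nra.
- have : sup (slopes x) <= (phi y - phi x) / (y - x).
    apply: ge_sup; last exact: slopes_le.
    by exists ((phi x - phi (x / 2)) / (x - x / 2)); exists (x / 2) => //=; lra.
  by rewrite ler_pdivlMr ?subr_gt0//; nra.
Qed.

(** Summation by parts: a nonincreasing weight puts more on the early terms,
    whose partial sums are nonnegative. *)
Lemma abel_sum_ge (R : realType) (n : nat) (c a : nat -> R) :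
  (forall k, (k < n)%N -> c k.+1 <= c k) ->
  (forall j, (j <= n)%N -> 0 <= \sum_(k < j) a k) ->
  c n * \sum_(k < n.+1) a k <= \sum_(k < n.+1) c k * a k.
Proof.
elim: n => [|n IH] cS aS; first by rewrite !big_ord1.
rewrite [leRHS]big_ord_recr/= [in leLHS]big_ord_recr/= mulrDr lerD2r.
have {}IH := IH (fun k kn => cS k (leqW kn)) (fun j jn => aS j (leqW jn)).
by apply: le_trans IH; rewrite ler_wpM2r ?aS ?cS.
Qed.

(** Karamata's inequality. Bounding [phi (x k)] from below by the tangent line
    at [y k] leaves the sum of [c (y k) * (x k - y k)], in which the weights are
    nonincreasing, since a subgradient is monotone, and the partial sums of
    [x k - y k] are nonnegative with total zero: summation by parts applies. *)
Lemma karamata (R : realType) (phi : R -> R) (n : nat) (x y : nat -> R) :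
  convex_function (`]0, +oo[%classic : set R) phi ->
  (forall k, (k < n)%N -> 0 < x k) -> (forall k, (k < n)%N -> 0 < y k) ->
  (forall k, (k.+1 < n)%N -> y k.+1 <= y k) ->
  (forall j, (j < n)%N -> \sum_(k < j) y k <= \sum_(k < j) x k) ->
  \sum_(k < n) y k = \sum_(k < n) x k ->
  \sum_(k < n) phi (y k) <= \sum_(k < n) phi (x k).
Proof.
case: n => [|n] phi_convex x0 y0 yS Syx Syx_eq; first by rewrite !big_ord0.
have [c cP] := convex_subgradient phi_convex.
apply: (@le_trans _ _ (\sum_(k < n.+1) (phi (y k) + c (y k) * (x k - y k)))).
  rewrite big_split/= lerDl.
  apply: le_trans (abel_sum_ge (c := c \o y) (a := fun k => x k - y k) _ _).
  - by rewrite sumrB Syx_eq subrr mulr0.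
  - move=> k kn /=; have k1 := y0 k.+1 kn; have k2 := y0 k (ltnW kn).
    have := yS _ kn; rewrite le_eqVlt => /predU1P[->//|ylt].
    (* Adding the subgradient inequalities at the two points gives
       (c (y k) - c (y k.+1)) * (y k - y k.+1) >= 0. *)
    have := cP _ _ k1 k2; have := cP _ _ k2 k1; nra.
  - by move=> j jn; rewrite sumrB subr_ge0 Syx.
by apply: ler_sum => k _; apply: cP; [exact: y0|exact: x0].
Qed.

(** * Majorization by ordered vectors *)

Section OrderedVectors.
Context {R : realType} {d : nat}.
Implicit Types u w xi l : 'cV[R]_d.

(** Listing the entries makes prefix sums range over natural numbers, where
    they can be compared and split without casts between ordinal types. *)
Definition entries u : seq R := [seq u i 0 | i : 'I_d].

Lemma nth_entries u (i : 'I_d) : (entries u)`_i = u i 0.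
Proof. by rewrite (nth_map i) ?nth_ord_enum// size_enum_ord. Qed.

Lemma nth_entriesE u k (kd : (k < d)%N) : (entries u)`_k = u (Ordinal kd) 0.
Proof. by rewrite -nth_entries. Qed.

Lemma sum_entries u : \sum_i u i 0 = \sum_(k < d) (entries u)`_k.
Proof. by apply: eq_bigr => i _; rewrite nth_entries. Qed.

Lemma sum_largest_ordered u j : ordered_vec u -> (j <= d)%N ->
  sum_largest j u = \sum_(k < j) (entries u)`_k.
Proof.
move=> ou jd; rewrite /sum_largest sorted_sort -/(entries u).
- rewrite (big_nth 0) big_mkord size_takel ?size_image ?card_ord//.
  by apply: eq_bigr => i _; rewrite nth_take.
- exact: ge_trans.
- apply/(sortedP 0) => k; rewrite size_image card_ord => kd.
  rewrite (nth_entriesE _ kd) (nth_entriesE _ (ltnW kd)).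
  exact: (ou (Ordinal (ltnW kd)) (Ordinal kd) (leqnSn k)).
Qed.

(** The definition of majorization bounds only the proper prefixes; the prefix
    of length [d] is covered by the equality of the totals. *)
Lemma majorizes_prefix u w j : ordered_vec u -> ordered_vec w ->
  majorizes u w -> (j <= d)%N ->
  \sum_(k < j) (entries w)`_k <= \sum_(k < j) (entries u)`_k.
Proof.
move=> ou ow [eq_uw le_uw]; rewrite leq_eqVlt => /predU1P[->|jd].
  by rewrite -!sum_entries eq_uw.
by rewrite -!sum_largest_ordered ?le_uw// ltnW.
Qed.

Lemma sum_entries_prefix u s : (s <= d)%N ->
  \sum_i u i 0 = \sum_(k < s) (entries u)`_k + \sum_(i < d | (s <= i)%N) u i 0.
Proof.
move=> sd; rewrite (bigID (fun i : 'I_d => (i < s)%N))/=; congr (_ + _).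
  rewrite (big_ord_widen _ (fun k => (entries u)`_k) sd).
  by apply: eq_bigr => i _; rewrite nth_entries.
by apply: eq_bigl => i; rewrite -leqNgt.
Qed.

(** A nonnegative vector that majorizes a vector supported on the first [s]
    coordinates already has its whole mass there: its prefix sum is at least the
    total of [l], which is its own total. *)
Lemma majorizes_prefix_eq xi l s :
  nonneg_vec xi -> ordered_vec xi -> ordered_vec l -> majorizes xi l ->
  (s <= d)%N -> (forall i : 'I_d, (s <= i)%N -> l i 0 = 0) ->
  \sum_(k < s) (entries l)`_k = \sum_(k < s) (entries xi)`_k.
Proof.
move=> xi0 oxi ol maj sd l0; apply/eqP.
rewrite eq_le majorizes_prefix//=.
have := maj.1; rewrite !(sum_entries_prefix _ sd) (big1 _ _ _ l0) addr0 => <-.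
by rewrite lerDl sumr_ge0.
Qed.

(** As the sums of the first [s] entries agree and those of the first [s.-1] are
    ordered by majorization, the last of these entries of [l] is at least that
    of [xi]; it is the smallest of the first [s] entries of [l]. *)
Lemma majorizes_prefix_gt0 xi l s :
  nonneg_vec xi -> ordered_vec xi -> ordered_vec l -> majorizes xi l ->
  (s <= d)%N -> (forall i : 'I_d, (s <= i)%N -> l i 0 = 0) ->
  (forall i : 'I_d, (i < s)%N -> 0 < xi i 0) ->
  forall i : 'I_d, (i < s)%N -> 0 < l i 0.
Proof.
move=> xi0 oxi ol maj; case: s => [//|s] sd l0 xi_gt0 i; rewrite ltnS => i_s.
apply: lt_le_trans (ol _ (Ordinal sd) i_s).
apply: lt_le_trans (xi_gt0 (Ordinal sd) (leqnn _)) _.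
have := majorizes_prefix_eq xi0 oxi ol maj sd l0.
rewrite !big_ord_recr/= !(nth_entriesE _ sd).
by have := majorizes_prefix oxi ol maj (ltnW sd); lra.
Qed.

Lemma f_s_fin phi s u : (s <= d)%N ->
  (forall i : 'I_d, (i < s)%N -> 0 < u i 0) ->
  f_s phi s u = (\sum_(k < s) phi (entries u)`_k)%:E.
Proof.
move=> sd u0; rewrite (big_ord_widen _ (fun k => phi (entries u)`_k) sd) -sumEFin.
by apply: eq_bigr => i si; rewrite /ext_phi u0// nth_entries.
Qed.

Lemma f_s_pinfty phi s u (i : 'I_d) : (i < s)%N -> u i 0 <= 0 ->
  f_s phi s u = +oo%E.
Proof.
move=> i_s ui; apply/eqP; rewrite /f_s esum_eqy.
  by apply/existsP; exists i; apply/andP; split=> //; rewrite /ext_phi ltNge ui/=.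
by move=> k _; rewrite /ext_phi; case: ifP.
Qed.

(** Either [f_s phi s xi] is infinite, or the first [s] entries of both vectors
    are positive and Karamata's inequality applies to them. *)
Lemma f_s_majorizes phi s xi l :
  convex_function (`]0, +oo[%classic : set R) phi ->
  nonneg_vec xi -> ordered_vec xi -> ordered_vec l -> majorizes xi l ->
  (s <= d)%N -> (forall i : 'I_d, (s <= i)%N -> l i 0 = 0) ->
  (f_s phi s l <= f_s phi s xi)%E.
Proof.
move=> phi_convex xi0 oxi ol maj sd l0.
have [xi_gt0|] := pselect (forall i : 'I_d, (i < s)%N -> 0 < xi i 0); last first.
  move=> /existsNP[i /not_implyP[i_s /negP]]; rewrite -leNgt.
  by move=> /(f_s_pinfty phi i_s)->; rewrite leey.
have l_gt0 := majorizes_prefix_gt0 xi0 oxi ol maj sd l0 xi_gt0.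
rewrite !f_s_fin// lee_fin.
have ltsd k : (k < s)%N -> (k < d)%N by move=> /leq_trans; apply.
apply: karamata => //.
- by move=> k ks; rewrite (nth_entriesE _ (ltsd _ ks)) xi_gt0.
- by move=> k ks; rewrite (nth_entriesE _ (ltsd _ ks)) l_gt0.
- move=> k ks; rewrite (nth_entriesE _ (ltsd _ ks)).
  by rewrite (nth_entriesE _ (ltsd _ (ltnW ks))) ol/=.
- by move=> j js; apply: majorizes_prefix => //; exact: ltnW (ltsd _ js).
- exact: majorizes_prefix_eq.
Qed.

End OrderedVectors.

(** * Vanishing eigenvalues of matrices of small rank *)

Lemma card_ord_geq (n r : nat) : (r <= n)%N ->
  #|[pred i : 'I_n | (r <= i)%N]| = (n - r)%N.
Proof.
move=> rn; rewrite -[n in RHS]card_ord -(cardC [pred i : 'I_n | (i < r)%N]).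
rewrite -[X in (X + _ - _)%N]sum1_card -(big_ord_widen _ (fun=> 1%N) rn).
rewrite sum1_card card_ord addKn; apply: eq_card => i.
by rewrite !inE -leqNgt.
Qed.

(** In a basis that starts with the columns spanning the image, the matrix has
    its nonzero rows among the first [\rank M]. The other rows of the
    characteristic matrix are then rows of ['X%:M], and one factor ['X] comes out
    of each. *)
Lemma char_poly_rank_dvdp (F : fieldType) (n : nat) (M : 'M[F]_n) :
  'X^(n - \rank M) %| char_poly M.
Proof.
pose L := col_ebase M; pose r := \rank M.
pose B := (pid_mx r : 'M[F]_n) *m (row_ebase M *m L).
have LB : L *m B = M *m L by rewrite /B !mulmxA mulmx_ebase.
have -> : char_poly M = char_poly B.
  rewrite /char_poly /char_poly_mx.
  have LE : ('X%:M - map_mx polyC M) *m map_mx polyC L =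
            map_mx polyC L *m ('X%:M - map_mx polyC B).
    by rewrite mulmxBr mulmxBl -!map_mxM LB scalar_mxC.
  have := congr1 determinant LE; rewrite !det_mulmx [RHS]mulrC => /mulIf; apply.
  by rewrite det_map_mx polyC_eq0 -unitfE -unitmxE col_ebase_unit.
(* [D] carries the factors taken out of the rows, [N] what remains of them. *)
pose D : 'rV[{poly F}]_n := \row_i (if (i < r)%N then 1 else 'X).
pose N : 'M[{poly F}]_n :=
  \matrix_(i, j) (if (i < r)%N then char_poly_mx B i j else (i == j)%:R).
have -> : char_poly B = \det (diag_mx D) * \det N.
  rewrite -det_mulmx mul_diag_mx; congr (\det _); apply/matrixP => i j.
  rewrite !mxE; case: ifPn => [_|ir]; first by rewrite mul1r.
  rewrite big1 ?subr0 ?mulr_natr// => k _.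
  by rewrite !mxE (negbTE ir) andbF mul0r.
rewrite dvdp_mulr// det_diag (bigID (fun i : 'I_n => (i < r)%N))/= dvdp_mull//.
rewrite (eq_bigr (fun=> 'X)) => [|i /negbTE ir]; last by rewrite mxE ir.
rewrite (eq_bigl (fun i : 'I_n => (r <= i)%N)) => [|i]; last by rewrite -leqNgt.
rewrite prodr_const card_ord_geq ?rank_leq_row//; exact: dvdpp.
Qed.

Lemma prod_XsubC_root0_count (F : fieldType) (n k : nat) (l : 'I_n -> F) :
  'X^k %| \prod_i ('X - (l i)%:P) -> (k <= #|[pred i | l i == 0%R]|)%N.
Proof.
rewrite (bigID (fun i => l i == 0))/= Gauss_dvdpl; last first.
  (* The factors of the nonzero roots are coprime to ['X]. *)
  apply: coprimep_expl; rewrite coprimep_sym -[X in coprimep _ X]subr0.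
  rewrite -(polyC0 F) coprimep_XsubC /root horner_prod.
  by apply/prodf_neq0 => i li; rewrite hornerXsubC sub0r oppr_eq0.
rewrite (eq_bigr (fun=> 'X)) => [|i /eqP->]; last by rewrite subr0.
by rewrite prodr_const dvdp_Pexp2l// size_polyX.
Qed.

(** For a left eigenvector [v] of eigenvalue [a], the quadratic form of [X] at
    [v] is [a] times the squared norm of [v]. *)
Lemma psd_is_eigvals_ge0 (R : realType) (d : nat) (X : 'M[R]_d) (l : 'cV[R]_d) :
  psdmx X -> is_eigvals X l -> nonneg_vec l.
Proof.
move=> [_ X0] [_ lP] i.
have : eigenvalue X (l i 0).
  rewrite eigenvalue_root_char lP /root horner_prod prodf_seq_eq0.
  by apply/hasP; exists i; rewrite ?mem_index_enum//= hornerXsubC subrr.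
move=> /eigenvalueP[v vX v0]; have := X0 v^T.
rewrite trmxK vX -scalemxAl mxE.
have vv : 0 < (v *m v^T) 0 0.
  rewrite mxE; have [j vj] : exists j, v 0 j != 0 by exact/rV0Pn.
  rewrite (bigD1 j)//= ltr_wpDr ?mxE -?expr2 ?exprn_even_gt0//.
  by apply: sumr_ge0 => k _; rewrite mxE -expr2 sqr_ge0.
by rewrite pmulr_lge0.
Qed.

(** At least [d - \rank X] eigenvalues vanish; as the eigenvalues are
    nonnegative and nonincreasing, these are the last ones. *)
Lemma is_eigvals_rank (R : realType) (d : nat) (X : 'M[R]_d) (l : 'cV[R]_d) :
  nonneg_vec l -> is_eigvals X l ->
  forall i : 'I_d, (\rank X <= i)%N -> l i 0 = 0.
Proof.
move=> l0 [ol lP] i ri; apply/eqP; apply: contraT => li.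
have := char_poly_rank_dvdp X; rewrite lP => /prod_XsubC_root0_count.
have sub : [pred j | l j 0 == 0] \subset [pred j : 'I_d | (i < j)%N].
  apply/fintype.subsetP => j; rewrite !inE => lj; rewrite ltnNge.
  apply: contra li => ji.
  by rewrite eq_le l0 andbT -(eqP lj) ol.
move=> /leq_trans /(_ (subset_leq_card sub)).
by rewrite card_ord_geq// leq_sub2lE// ltnNge ri.
Qed.

(** * The matrix of a binary point *)

(** A diagonal matrix is a sum of matrices of rank at most one, one for each
    nonzero diagonal entry. *)
Lemma rank_diag_mx_le (F : fieldType) (n : nat) (v : 'rV[F]_n) :
  (\rank (diag_mx v) <= \sum_i (v 0 i != 0)%R)%N.
Proof.
rewrite diag_mx_sum_delta.
elim/big_ind2: _ => [|A1 m1 A2 m2 h1 h2|i _]; first by rewrite mxrank0.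
  exact: leq_trans (mxrank_add _ _) (leq_add h1 h2).
have [->|v0] := eqVneq (v 0 i) 0; first by rewrite scale0r mxrank0.
by rewrite mxrank_scale_nz// mxrank_delta.
Qed.

Lemma rank_VDiagVT_binary (R : realType) (d s : nat) (V : 'M[R]_d)
    (x : 'cV[R]_d) :
  binary_vec x -> \sum_i x i 0 = s%:R -> (\rank (VDiagVT V x) <= s)%N.
Proof.
move=> x01 xs; apply: leq_trans (mxrankM_maxl _ _) _.
apply: leq_trans (mxrankM_maxr _ _) _; apply: leq_trans (rank_diag_mx_le _) _.
rewrite -(ler_nat R) natr_sum -xs; apply: ler_sum => i _; rewrite mxE.
by case: (x01 i) => ->; rewrite ?eqxx ?oner_neq0.
Qed.

Lemma psd_VDiagVT (R : realType) (d : nat) (V : 'M[R]_d) (x : 'cV[R]_d) :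
  nonneg_vec x -> psdmx (VDiagVT V x).
Proof.
move=> x0; split; first by rewrite /VDiagVT !trmx_mul trmxK tr_diag_mx mulmxA.
move=> v; rewrite /VDiagVT !mulmxA -mulmxA.
have -> : V^T *m v = (v^T *m V)^T by rewrite trmx_mul trmxK.
rewrite mul_mx_diag mxE sumr_ge0// => i _; rewrite !mxE -mulrA mulrCA.
by rewrite mulr_ge0// -expr2 sqr_ge0.
Qed.

Lemma binary_psd (R : realType) (d : nat) (V : 'M[R]_d) (x : 'cV[R]_d) :
  binary_vec x -> psdmx (VDiagVT V x).
Proof. by move=> x01; apply: psd_VDiagVT => i; case: (x01 i) => ->. Qed.

Lemma binary_is_eigvals (R : realType) (d : nat) (V : 'M[R]_d) (x : 'cV[R]_d) :
  binary_vec x -> is_eigvals (VDiagVT V x) (eigvals (VDiagVT V x)).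
Proof. by move=> /(binary_psd V)[sX _]; exact: eigvalsP. Qed.

Lemma binary_eigvals_ge0 (R : realType) (d : nat) (V : 'M[R]_d) (x : 'cV[R]_d) :
  binary_vec x -> nonneg_vec (eigvals (VDiagVT V x)).
Proof.
move=> x01.
exact: psd_is_eigvals_ge0 (binary_psd V x01) (binary_is_eigvals V x01).
Qed.

(** A binary point with [s] ones selects [s] columns of [V], so at most the
    first [s] eigenvalues are nonzero; this is the support condition under
    which majorization of the whole vectors controls [f_s], which sees only the
    first [s] coordinates. *)
Lemma f_s_binary_eigvals_le (R : realType) (d s : nat) (phi : R -> R)
    (V : 'M[R]_d) (x xi : 'cV[R]_d) :
  convex_function (`]0, +oo[%classic : set R) phi -> (s <= d)%N ->
  binary_vec x -> \sum_i x i 0 = s%:R ->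
  nonneg_vec xi -> majorizes xi (eigvals (VDiagVT V x)) -> ordered_vec xi ->
  (f_s phi s (eigvals (VDiagVT V x)) <= f_s phi s xi)%E.
Proof.
move=> phi_convex sd x01 xs xi0 maj oxi; have eigX := binary_is_eigvals V x01.
apply: f_s_majorizes => //; first exact: eigX.1.
move=> i si; apply: (is_eigvals_rank (binary_eigvals_ge0 V x01) eigX).
exact: leq_trans (rank_VDiagVT_binary V x01 xs) si.
Qed.

Theorem proposition4 (R : realType) (d s m : nat) (phi : R -> R)
    (V C : 'M[R]_d) (A : 'M[R]_(m, d)) (b : 'cV[R]_m)
    (phi_closed : lower_semicontinuous (ext_phi phi))
    (phi_convex : convex_function (`]0, +oo[%classic : set R) phi)
    (phi_noninc : {in `]0, +oo[ &, {homo phi : x y /~ x <= y}})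
    (s_bounds : (1 <= s <= d)%N)
    (defC : C = V^T *m V)
    (s_rank : (s <= \rank C)%N) :
  let calX := feasible A b s in
  proj_set phi s V calX Omega_bar `&` (setT `*` binary_vec)
    = proj_set phi s V calX Omega_hat `&` (setT `*` binary_vec)
  /\ forall x : 'cV[R]_d, (calX `&` binary_vec) x ->
       g_s phi s (eigvals (VDiagVT V x)) = f_s phi s (eigvals (VDiagVT V x)).
Proof.
move=> calX; have /andP[_ sd] := s_bounds; split.
  apply/seteqP; split=> -[t x] [[/= Xx [xi [xi0 fxi]]]].
    move=> [/= _ psdX xiE oxi] [_ xb]; split => //; split => //.
    by exists xi; split => //; split => //=; rewrite xiE; split.
  move=> [/= _ psdX maj oxi] [_ xb]; split => //; split => //.
  case: (Xx) => _ xs _.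
  exists (eigvals (VDiagVT V x)); split.
  - exact: binary_eigvals_ge0.
  - by apply: le_trans fxi; exact: f_s_binary_eigvals_le.
  - split => //=; first exact: binary_eigvals_ge0.
    exact: (binary_is_eigvals V xb).1.
move=> x [[_ xs _] xb]; apply/eqP; rewrite eq_le; apply/andP; split.
  (* The eigenvalue vector is feasible since majorization is reflexive. *)
  apply: ereal_inf_lbound; exists (eigvals (VDiagVT V x)) => //.
  split; [exact: binary_eigvals_ge0 | by split | exact: (binary_is_eigvals V xb).1].
apply/ereal_infP => _ [xi [xi0 maj oxi] <-].
exact: f_s_binary_eigvals_le.
Qed.
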